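(* Let $\tau>0$ and $k\in\mathbb R$. If $(x,T)$ is a critical point of $\mathcal L_k^{\le\tau}$ with $T<\tau$, then $k\ge k_0(L;x_\pm)$.
   Context: Let $\sigma>0$ and let $V:\mathbb R^n\to\mathbb R$ satisfy: (1) $V$ is of class $C^4$; (2) $U(x):=\sigma\Delta V(x)-\frac12|\nabla V(x)|^2$ is bounded from above and its maximum points are contained in a bounded domain; (3) $V$ has two local minimizers $x_0,x_1$ with $\nabla V(x_0)=\nabla V(x_1)=0$ and $\Delta V(x_0)>0$, $\Delta V(x_1)>0$. Put $L(x,v)=\frac12|v|^2-U(x)$ and let $H:T^*\mathbb R^n\to\mathbb R$ be its Legendre dual, $H(q,p)=\sup_{v}\{\langle p,v\rangle-L(q,v)\}=\frac12|p|^2+U(q)$. Fix $x_-,x_+\in\mathbb R^n$ and let $W^{1,2}_{x_\pm}([0,1],\mathbb R^n)=\{x\in W^{1,2}([0,1],\mathbb R^n): x(0)=x_-,\ x(1)=x_+\}$. For $k\in\mathbb R$ let $$\mathcal L_k(x,T)=T\int_0^1\big(L(x(t),\dot x(t)/T)+k\big)\,dt,\qquad (x,T)\in W^{1,2}_{x_\pm}([0,1],\mathbb R^n)\times(0,\infty),$$ and let $\mathcal L_k^{\le\tau}$ be its restriction to $W^{1,2}_{x_\pm}([0,1],\mathbb R^n)\times(0,\tau]$. A critical point is a pair $(x,T)$ with $d\mathcal L_k(x,T)[(\xi,b)]=0$ for all $\xi\in W^{1,2}([0,1],\mathbb R^n)$ with $\xi(0)=\xi(1)=0$ and all $b\in\mathbb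 R$. Finally $$k_0(L;x_\pm)=\inf\{k\in\mathbb R:\ \text{there is a connected component }\Omega\text{ of }H^{-1}(k)\text{ with }\Omega\cap T^*_{x_-}\mathbb R^n\ne\emptyset\text{ and }\Omega\cap T^*_{x_+}\mathbb R^n\neq\emptyset\}.$$ *)

(* Defs.v *)
From HB Require Import structures.
From mathcomp Require Import all_boot all_order all_algebra.
From mathcomp Require Import all_classical all_reals all_analysis.
From mathcomp Require Import ring lra.

Set Implicit Arguments.
Unset Strict Implicit.
Unset Printing Implicit Defensive.

Import Order.TTheory GRing.Theory Num.Theory.
Import numFieldTopology.Exports numFieldNormedType.Exports.

Local Open Scope classical_set_scope.
Local Open Scope ring_scope.

Section Euclidean.
Context {R : realType} {n : nat}.
Implicit Types (u v : 'rV[R]_n) (f : 'rV[R]_n -> R).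

(* The library norm of 'rV[R]_n is the sup norm; lengths below are Euclidean
   and are written with [dot]. *)
Definition dot u v : R := \sum_i u 0 i * v 0 i.

Definition sqnorm v : R := dot v v.

Definition basis_vec (i : 'I_n) : 'rV[R]_n := delta_mx 0 i.

Definition partial (i : 'I_n) f : 'rV[R]_n -> R :=
  fun x => 'D_(basis_vec i) f x.

Definition grad f (x : 'rV[R]_n) : 'rV[R]_n := \row_i partial i f x.

Definition laplacian f (x : 'rV[R]_n) : R := \sum_i partial i (partial i f) x.

(* The Frechet differential of f is C^m iff all partial derivatives of f are. *)
Fixpoint of_class_C (m : nat) f : Prop :=
  if m is m'.+1 then
    (forall x, differentiable f x) /\ (forall i, of_class_C m' (partial i f))
  else continuous f.

Definition local_minimizer f (x : 'rV[R]_n) : Prop :=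
  \forall y \near x, f x <= f y.

Definition maximum_points f : set 'rV[R]_n := [set x | forall y, f y <= f x].

Definition bounded_domain (D : set 'rV[R]_n) : Prop :=
  [/\ open D, connected D & bounded_set D].

End Euclidean.

(* W^{1,2}([0,1], R^n).  Elements are represented by their continuous
   representative, extended arbitrarily to a function on R: only the values on
   [0,1] are used. *)
Section Sobolev.
Context {R : realType} {n : nat}.
Implicit Types (x g : R -> 'rV[R]_n).

Local Notation mu := (@lebesgue_measure R).
Local Notation I01 := (`[0%R, 1%R]%classic : set R).

Definition C1_test_function (phi : R -> R) : Prop :=
  [/\ forall t, derivable phi t 1,
      continuous (derive1 phi) &
      exists a b : R, [/\ 0 < a, b < 1 & forall t, t \notin `[a, b] -> phi t = 0]].

Definition L2 (g : R -> R) : Prop :=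
  measurable_fun I01 g /\
  mu.-integrable I01 (fun t => (g t ^+ 2)%:E).

Definition is_weak_derivative x g : Prop :=
  forall i : 'I_n, L2 (fun t => g t 0 i) /\
    forall phi, C1_test_function phi ->
      \int[mu]_(t in I01) (x t 0 i * derive1 phi t) =
      - \int[mu]_(t in I01) (g t 0 i * phi t).

Definition W12 : set (R -> 'rV[R]_n) :=
  [set x | {within I01, continuous x} /\
           exists g, is_weak_derivative x g].

Definition W12_bc (xm xp : 'rV[R]_n) : set (R -> 'rV[R]_n) :=
  [set x | [/\ W12 x, x 0 = xm & x 1 = xp]].

(* A weak derivative is unique only up to a Lebesgue-null subset of [0,1]; one
   is chosen, and it is only used under an integral over [0,1]. *)
Definition weak_derivative x : R -> 'rV[R]_n := [get g | is_weak_derivative x g].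

End Sobolev.

(* A Lagrangian is a function L q v on the tangent bundle R^n x R^n. *)
Section FreePeriodAction.
Context {R : realType} {n : nat}.
Variable L : 'rV[R]_n -> 'rV[R]_n -> R.

Local Notation mu := (@lebesgue_measure R).
Local Notation I01 := (`[0%R, 1%R]%classic : set R).

Definition action (k : R) (x : R -> 'rV[R]_n) (T : R) : R :=
  T * \int[mu]_(t in I01) (L (x t) (T^-1 *: weak_derivative x t) + k).

(* [has_differential k x T xi b l] : dL_k(x,T)[(xi,b)] exists and equals l. *)
Definition has_differential (k : R) (x : R -> 'rV[R]_n) (T : R)
    (xi : R -> 'rV[R]_n) (b l : R) : Prop :=
  is_derive (0 : R) (1 : R) (fun s => action k (fun t => x t + s *: xi t) (T + s * b)) l.

(* Critical points of the restriction of L_k to W^{1,2}_{xm,xp} x (0,tau]. *)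
Definition critical_point_le (tau : R) (xm xp : 'rV[R]_n) (k : R)
    (x : R -> 'rV[R]_n) (T : R) : Prop :=
  [/\ W12_bc xm xp x, 0 < T <= tau &
      forall xi b, W12_bc 0 0 xi -> has_differential k x T xi b 0].

Definition legendre_dual (q p : 'rV[R]_n) : R :=
  sup [set dot p v - L q v | v in [set: 'rV[R]_n]].

Definition energy_level (k : R) : set ('rV[R]_n * 'rV[R]_n) :=
  [set z | legendre_dual z.1 z.2 = k].

Definition cotangent_fiber (q : 'rV[R]_n) : set ('rV[R]_n * 'rV[R]_n) :=
  [set z | z.1 = q].

Definition is_connected_component {T : topologicalType} (A Omega : set T) :=
  exists2 z, A z & Omega = connected_component A z.

(* The infimum is taken in the extended reals, so that inf set0 = +oo. *)
Definition k0 (xm xp : 'rV[R]_n) : \bar R :=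
  ereal_inf [set k%:E | k in [set k : R |
    exists Omega, [/\ is_connected_component (energy_level k) Omega,
      Omega `&` cotangent_fiber xm !=set0 &
      Omega `&` cotangent_fiber xp !=set0]]].

End FreePeriodAction.

Section OnsagerMachlup.
Context {R : realType} {n : nat}.

Definition potential (sigma : R) (V : 'rV[R]_n -> R) (x : 'rV[R]_n) : R :=
  sigma * laplacian V x - 2^-1 * sqnorm (grad V x).

Definition lagrangian (U : 'rV[R]_n -> R) (x v : 'rV[R]_n) : R :=
  2^-1 * sqnorm v - U x.

Lemma legendre_dual_lagrangian (U : 'rV[R]_n -> R) (q p : 'rV[R]_n) :
  legendre_dual (lagrangian U) q p = 2^-1 * sqnorm p + U q.
Proof.
have ub v : dot p v - lagrangian U q v <= 2^-1 * sqnorm p + U q.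
  suff : dot p v <= 2^-1 * sqnorm p + 2^-1 * sqnorm v by rewrite /lagrangian; lra.
  rewrite /sqnorm /dot !mulr_sumr -big_split /=; apply: ler_sum => i _.
  by have := sqr_ge0 (p 0 i - v 0 i); nra.
have att : [set dot p v - lagrangian U q v | v in [set: 'rV[R]_n]]
    (2^-1 * sqnorm p + U q).
  by exists p => //; rewrite /lagrangian /sqnorm; lra.
apply/eqP; rewrite eq_le; apply/andP; split.
  by apply: ge_sup => [|_ [v _ <-]]; [exists (2^-1 * sqnorm p + U q)|exact: ub].
by apply: ub_le_sup => //; exists (2^-1 * sqnorm p + U q) => _ [v _ <-].
Qed.

End OnsagerMachlup.

(* Main.v *)
Require Import Defs.
From mathcomp Require Import all_boot all_order all_algebra.
From mathcomp Require Import all_classical all_reals all_analysis.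
From mathcomp Require Import measurable_realfun ring lra.
Import Order.TTheory GRing.Theory Num.Theory.
Import numFieldTopology.Exports numFieldNormedType.Exports.
Local Open Scope classical_set_scope.
Local Open Scope ring_scope.

(** A critical path is a solution of Newton's equation whose energy is exactly [k], so
it lifts to a curve in the level [k] of the Hamiltonian that joins the two
fibers.  A connected component of the level then meets both fibers, [k] belongs
to the set whose infimum is [k0], and the inequality follows.

Write [g] for a weak derivative of the path [x].  The action depends on [g] only
through its class modulo null sets, because weak derivatives are unique almost
everywhere; it equals
  T * ((2 T^2)^-1 * int |g|^2 - int U(x) + k)
([action_lagrangian]).  As [U] is of class C^1 ([potential_of_class_C1]), this can be
differentiated.  Two families of variations suffice.

- Varying one coordinate of [x] by a test function [phi] gives the weak equation
  int g_i phi' = T^2 int (d_i U)(x) phi ([critical_weak_equation]).  By the lemma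
  of du Bois-Reymond, [g_i] agrees almost everywhere with a function [p_i] whose
  derivative is - T^2 (d_i U)(x), and [x_i] itself is a primitive of [p_i]
  ([weak_euler_lagrange], [weak_primitive]).  Hence the energy
  |p|^2 / (2 T^2) + U(x) has derivative zero and is constant on [0,1].

- Varying [T] alone shows that the mean of the energy over [0,1] is [k]
  ([critical_mean_energy]), so the constant is [k].

The curve t |-> (x t, p t / T) is thus continuous and stays in the level [k]
([critical_level_connected]).

The analytic input is the fundamental lemma of the calculus of variations for
continuously differentiable test functions ([fundamental_lemma]).  Testing
against plateaus that tend to the indicator of an interval ]0, b[ shows that
the primitive of the given function vanishes, and Lebesgue's differentiation
theorem concludes.  *)

Set Implicit Arguments.
Unset Strict Implicit.
Unset Printing Implicit Defensive.

(** * Integration on the unit interval *)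

Section Integrability.
Context {R : realType}.
Implicit Types (f g h F phi : R -> R).

Local Notation mu := (@lebesgue_measure R).
Local Notation I01 := (`[0%R, 1%R]%classic : set R).
Local Notation integrable01 f := (mu.-integrable I01 (EFin \o f)).

Lemma measurable01 : measurable (I01 : set (measurableTypeR R)).
Proof. exact: measurable_itv. Qed.

Lemma lebesgue_measure01 : mu I01 = 1%E.
Proof. by rewrite lebesgue_measure_itv/= lte_fin ltr01 -EFinB subr0. Qed.

Lemma integral01_cst (k : R) : \int[mu]_(t in I01) k = k.
Proof.
rewrite Rintegral_cst; last exact: measurable01.
rewrite [X in fine X](_ : _ = 1%E) ?mulr1//; exact: lebesgue_measure01.
Qed.

Lemma integrable01_within f : {within I01, continuous f} -> integrable01 f.
Proof. by apply: continuous_compact_integrable; exact: segment_compact. Qed.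

Lemma integrable01_continuous f : continuous f -> integrable01 f.
Proof. by move=> cf; apply: integrable01_within; exact: continuous_subspaceT. Qed.

Lemma integrable01D f g : integrable01 f -> integrable01 g ->
  integrable01 (fun t => f t + g t).
Proof. by move=> fi gi; have := integrableD measurable01 fi gi. Qed.

Lemma integrable01Z c f : integrable01 f -> integrable01 (fun t => c * f t).
Proof. by move=> fi; have := integrableZl measurable01 c fi. Qed.

Lemma integrable01B f g : integrable01 f -> integrable01 g ->
  integrable01 (fun t => f t - g t).
Proof. by move=> fi gi; have := integrableB measurable01 fi gi. Qed.

Lemma integrable01_eq f g : (forall t, t \in I01 -> f t = g t) ->
  integrable01 f -> integrable01 g.
Proof.
move=> fg; apply: eq_integrable; first exact: measurable01.
by move=> t tI /=; rewrite fg.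
Qed.

Lemma integrable01_sum n (f : 'I_n -> R -> R) :
  (forall i, integrable01 (f i)) -> integrable01 (fun t => \sum_i f i t).
Proof.
move=> fi; rewrite (_ : EFin \o _ = (fun t => \sum_i (f i t)%:E)%E); last first.
  by apply/funext => t /=; rewrite sumEFin.
by apply: integrable_sum => // i _; exact: fi.
Qed.

Lemma integrable01M f phi : integrable01 f -> {within I01, continuous phi} ->
  integrable01 (fun t => f t * phi t).
Proof.
move=> fi cphi; have := @integrableMl _ _ _ mu _ measurable01 _ phi fi.
apply.
  by apply: subspace_continuous_measurable_fun => //; exact: measurable01.
have /compact_bounded[M [Mr MP]] :=
  continuous_compact cphi (@segment_compact _ 0 1).
by exists M; split=> // x Mx y Iy; apply: MP => //; exists y.
Qed.

(** On a space of finite measure L2 is contained in L1; here this comes from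
|g| <= 1 + g^2. *)
Lemma integrable01_L2 g : L2 g -> integrable01 g.
Proof.
move=> [mg ig].
have i1 : integrable01 (fun t => 1 + g t ^+ 2).
  by apply: integrable01D => //; apply: integrable01_continuous => t; exact: cvg_cst.
apply: (le_integrable measurable01 _ _ i1); first exact/measurable_EFinP.
move=> t _ /=; rewrite lee_fin.
rewrite [leRHS]ger0_norm ?addr_ge0 ?sqr_ge0// -(real_normK (num_real (g t))).
by have := sqr_ge0 (`|g t| - 1); have := normr_ge0 (g t); nra.
Qed.

Lemma L2D g h : L2 g -> L2 h -> L2 (fun t => g t + h t).
Proof.
move=> [mg ig] [mh ih]; split; first exact: measurable_funD.
have i2 : integrable01 (fun t => 2 * (g t ^+ 2 + h t ^+ 2)).
  exact/integrable01Z/integrable01D.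
apply: (le_integrable measurable01 _ _ i2).
  by apply/measurable_EFinP; apply: measurable_funX; exact: measurable_funD.
move=> t _ /=; rewrite lee_fin ger0_norm ?sqr_ge0// ger0_norm; last first.
  by rewrite mulr_ge0 ?ler0n ?addr_ge0 ?sqr_ge0.
by have := sqr_ge0 (g t - h t); nra.
Qed.

Lemma L2_continuous f : continuous f -> L2 f.
Proof.
move=> cf; split.
  by apply: measurable_funTS; exact: continuous_measurable_fun.
by apply: integrable01_continuous => t; apply: (cvgM (cf t) (cf t)).
Qed.

Lemma L2Z c f : L2 f -> L2 (fun t => c * f t).
Proof.
move=> [mf fi]; split; first exact: measurable_funM.
apply: (@integrable01_eq (fun t => c ^+ 2 * f t ^+ 2)); last exact: integrable01Z.
by move=> t _; rewrite exprMn.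
Qed.

Lemma is_derive01_oo_LRcontinuous F f : (forall t : R, 0 <= t <= 1 -> is_derive t (1 : R) F (f t)) ->
  derivable_oo_LRcontinuous F 0 1 /\ {in `]0, 1[, derive1 F =1 f}.
Proof.
move=> dF; have cF (t : R) : 0 <= t <= 1 -> {for t, continuous F}.
  move=> /dF H; apply: differentiable_continuous; apply/derivable1_diffP.
  exact: ex_derive.
split; last first.
  move=> t; rewrite in_itv/= => /andP[t0 t1]; rewrite derive1E.
  by apply: derive_val; apply: dF; rewrite !ltW.
split.
- move=> t; rewrite in_itv/= => /andP[t0 t1].
  by have H : is_derive t 1 F (f t) by [apply: dF; rewrite !ltW|]; exact: ex_derive.
- by apply: cvg_at_right_filter; apply: cF; rewrite lexx ler01.
- by apply: cvg_at_left_filter; apply: cF; rewrite lexx ler01.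
Qed.

Lemma test_endpoints phi : C1_test_function phi -> phi 0 = 0 /\ phi 1 = 0.
Proof.
move=> [_ _ [a [b [a0 b1 H]]]]; split; apply: H; rewrite in_itv/= negb_and -!ltNge ?a0//.
by rewrite b1 orbT.
Qed.

(** The boundary terms disappear because a test function vanishes at both ends. *)
Lemma integration_by_parts_test F f phi :
  (forall t : R, 0 <= t <= 1 -> is_derive t (1 : R) F (f t)) -> {within I01, continuous f} ->
  C1_test_function phi ->
  \int[mu]_(t in I01) (F t * derive1 phi t) = - \int[mu]_(t in I01) (f t * phi t).
Proof.
move=> /is_derive01_oo_LRcontinuous[dF Ff] cf tphi; have [phi0 phi1] := test_endpoints tphi.
have [dphi cphi _] := tphi.
have dphi1 (t : R) : 0 <= t <= 1 -> is_derive t (1 : R) phi (derive1 phi t).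
  by move=> _; rewrite derive1E; exact: derivableP.
have [dp pp] := is_derive01_oo_LRcontinuous dphi1.
have cphi1 : {within I01, continuous (derive1 phi)} by exact: continuous_subspaceT.
have H := Rintegration_by_parts (ltr01 : (0 : R) < 1) cf dF Ff cphi1 dp pp.
by rewrite H phi0 phi1 !mulr0 subr0 add0r.
Qed.

(** The base point [a] is kept strictly below [t], so that a primitive on the
closed unit interval, two-sided derivatives at 0 included, is obtained with the
base point -1. *)
Lemma is_derive_primitive f (a t : R) : continuous f -> a < t ->
  is_derive t (1 : R) (fun u : R => \int[mu]_(s in `[a, u]) f s) (f t).
Proof.
move=> cf at_; have tt1 : t < t + 1 by rewrite ltrDl.
have fi : mu.-integrable `[a, t + 1] (EFin \o f).
  apply: continuous_compact_integrable; first exact: segment_compact.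
  exact: continuous_subspaceT.
have [dF <-] := continuous_FTC1_closed tt1 fi at_ (cf t).
by rewrite derive1E; exact: derivableP.
Qed.

End Integrability.

(** * Continuously differentiable plateaus *)

Section Plateaus.
Context {R : realType}.
Implicit Types (f g h F phi : R -> R).

Local Notation mu := (@lebesgue_measure R).
Local Notation I01 := (`[0%R, 1%R]%classic : set R).
Local Notation integrable01 f := (mu.-integrable I01 (EFin \o f)).

(** A quadratic remainder bound gives derivatives without any case
distinction at the points where a formula changes. *)
Lemma is_derive_quadratic f (t l C : R) :
  (forall u, `|f u - f t - l * (u - t)| <= C * (u - t) ^+ 2) ->
  is_derive t (1 : R) f l.
Proof.
move=> H.
have C0 : 0 <= C.
  have := H (t + 1); rewrite [t + 1]addrC addrK expr1n !mulr1.
  by apply: le_trans; exact: normr_ge0.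
suff cvgl : h^-1 *: (f (h *: 1 + t) - f t) @[h --> 0^'] --> l.
  by apply: DeriveDef; [apply/cvg_ex; exists l|exact: cvg_lim].
apply/cvgrPdist_le => e e0; near=> h.
have h0 : h != 0 by near: h; exact: nbhs_dnbhs_neq.
have := H (h + t); rewrite addrK [h%:A]mulr1 => Hh.
(* The difference quotient differs from l by the remainder divided by h. *)
have -> : l - h^-1 *: (f (h + t) - f t) = - (h^-1 * (f (h + t) - f t - l * h)).
  by rewrite /GRing.scale/=; field.
rewrite normrN normrM normfV ler_pdivrMl ?normr_gt0//.
have hC : `|h| <= e / (C + 1).
  by near: h; apply: dnbhs0_le; rewrite divr_gt0// ltr_wpDl.
rewrite ler_pdivlMr ?ltr_wpDl// in hC.
apply: (le_trans Hh); rewrite -(real_normK (num_real h)).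
by have := normr_ge0 h; nra.
Unshelve. all: by end_near. Qed.

(** Its square is the simplest C^1 function vanishing on a half-line. *)
Definition pospart t : R := Num.max 0 t.

Lemma pospart_sqr_remainder (y z : R) :
  `|pospart y ^+ 2 - pospart z ^+ 2 - 2 * pospart z * (y - z)| <= (y - z) ^+ 2.
Proof.
have := sqr_ge0 (y - z); have := sqr_ge0 z; have := sqr_ge0 y.
rewrite ler_norml /pospart !expr2 => y2 z2 yz2.
by case: (leP 0 y) => y0; case: (leP 0 z) => z0; apply/andP; split; nra.
Qed.

Lemma is_derive_pospart_sqrBr (a t : R) :
  is_derive t (1 : R) (fun u => pospart (u - a) ^+ 2) (2 * pospart (t - a)).
Proof.
apply: (@is_derive_quadratic _ _ _ 1) => u; rewrite mul1r.
by rewrite (_ : u - t = u - a - (t - a)) ?pospart_sqr_remainder//; ring.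
Qed.

Lemma is_derive_pospart_sqrBl (b t : R) :
  is_derive t (1 : R) (fun u => pospart (b - u) ^+ 2) (- (2 * pospart (b - t))).
Proof.
apply: (@is_derive_quadratic _ _ _ 1) => u; rewrite mul1r mulNr -mulrN -[(u - t) ^+ 2]sqrrN.
by rewrite (_ : - (u - t) = b - u - (b - t)) ?pospart_sqr_remainder//; ring.
Qed.

Lemma continuous_pospart f : continuous f -> continuous (fun t => pospart (f t)).
Proof. by move=> cf t; apply: continuous_max; [exact: cvg_cst|exact: cf]. Qed.

(** A C^1 function that is positive exactly on ]a, b[. *)
Definition hump (a b t : R) : R := pospart (t - a) ^+ 2 * pospart (b - t) ^+ 2.

Definition dhump (a b t : R) : R :=
  2 * pospart (t - a) * pospart (b - t) ^+ 2 - pospart (t - a) ^+ 2 * (2 * pospart (b - t)).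

Lemma is_derive_hump (a b t : R) : is_derive t (1 : R) (hump a b) (dhump a b t).
Proof.
have := is_deriveM (is_derive_pospart_sqrBr a t) (is_derive_pospart_sqrBl b t).
by move/is_derive_eq; apply; rewrite /dhump /GRing.scale/=; ring.
Qed.

Lemma hump_ge0 a b t : 0 <= hump a b t.
Proof. by rewrite mulr_ge0// sqr_ge0. Qed.

(** Composing the hump with y |-> c y / (1 + c y) keeps it C^1 and supported in
[a, b], bounds it by 1, and makes it tend to the indicator of ]a, b[ as [c] grows. *)
Definition plateau (c a b t : R) : R := 1 - (1 + c * hump a b t)^-1.

Lemma is_derive_plateau (c a b t : R) : 0 <= c ->
  is_derive t (1 : R) (plateau c a b) (c * dhump a b t * (1 + c * hump a b t) ^- 2).
Proof.
move=> c0; have h0 : 1 + c * hump a b t != 0.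
  by rewrite gt_eqF// ltr_pwDl// mulr_ge0// hump_ge0.
have H1 : is_derive t (1 : R) (fun u => 1 + c * hump a b u) (c * dhump a b t).
  have := is_deriveD (is_derive_cst (1 : R) t 1) (is_deriveZ c (is_derive_hump a b t)).
  by move/is_derive_eq; apply; rewrite add0r.
have := is_deriveB (is_derive_cst (1 : R) t 1) (@is_deriveV _ (fun u => 1 + c * hump a b u) t _ 1 h0 H1).
by move/is_derive_eq; apply; rewrite /GRing.scale/= sub0r mulNr opprK mulrC.
Qed.

Lemma C1_test_functionI phi dphi (a b : R) :
  (forall t : R, is_derive t (1 : R) phi (dphi t)) -> continuous dphi ->
  0 < a -> b < 1 -> (forall t, t \notin `[a, b] -> phi t = 0) ->
  C1_test_function phi /\ derive1 phi = dphi.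
Proof.
move=> dp cd a0 b1 s; have e : derive1 phi = dphi.
  by apply/funext => t; rewrite derive1E; exact: derive_val.
split=> //; split; last by exists a, b.
- by move=> t; exact: ex_derive.
- by rewrite e.
Qed.

Lemma continuous_hump (a b : R) : continuous (hump a b).
Proof.
move=> t; apply: differentiable_continuous; apply/derivable1_diffP.
by have H := is_derive_hump a b t; exact: ex_derive.
Qed.

Lemma continuous_dhump (a b : R) : continuous (dhump a b).
Proof.
have c1 : continuous (fun u : R => pospart (u - a)).
  by apply: continuous_pospart => u; apply: cvgB; [exact: cvg_id|exact: cvg_cst].
have c2 : continuous (fun u : R => pospart (b - u)).
  by apply: continuous_pospart => u; apply: cvgB; [exact: cvg_cst|exact: cvg_id].
move=> t; apply: cvgB; apply: cvgM.
- by apply: cvgM; [exact: cvg_cst|exact: c1].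
- by apply: cvgM; exact: c2.
- by apply: cvgM; exact: c1.
- by apply: cvgM; [exact: cvg_cst|exact: c2].
Qed.

Lemma hump_eq0 (a b t : R) : t \notin `[a, b] -> hump a b t = 0.
Proof.
rewrite in_itv/= negb_and -!ltNge /hump /pospart => /orP[ta|bt].
  by rewrite (max_idPl _) ?expr0n ?mul0r//; lra.
by rewrite [X in _ * X ^+ 2](max_idPl _) ?expr0n ?mulr0//; lra.
Qed.

Lemma plateau_eq0 (c a b t : R) : t \notin `[a, b] -> plateau c a b t = 0.
Proof. by move=> /hump_eq0 h0; rewrite /plateau h0 mulr0 addr0 invr1 subrr. Qed.

Lemma plateau_test (c a b : R) : 0 <= c -> 0 < a -> b < 1 ->
  C1_test_function (plateau c a b).
Proof.
move=> c0 a0 b1.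
have [] // := @C1_test_functionI (plateau c a b)
  (fun t => c * dhump a b t * (1 + c * hump a b t) ^- 2) a b.
- by move=> t; exact: is_derive_plateau.
- move=> t; apply: cvgM; first by apply: cvgM; [exact: cvg_cst|exact: continuous_dhump].
  apply: cvgV; first by rewrite expf_neq0// gt_eqF// ltr_pwDl// mulr_ge0// hump_ge0.
  have H : 1 + c * hump a b t0 @[t0 --> t] --> 1 + c * hump a b t.
    apply: cvgD; first exact: cvg_cst.
    by apply: cvgM; [exact: cvg_cst|exact: continuous_hump].
  exact: (cvgM H H).
- by move=> t; exact: plateau_eq0.
Qed.

Lemma plateau_bound (c a b t : R) : 0 <= c -> 0 <= plateau c a b t <= 1.
Proof.
move=> c0; have h1 : 1 <= 1 + c * hump a b t by rewrite lerDl mulr_ge0// hump_ge0.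
rewrite /plateau subr_ge0 invf_le1 ?(lt_le_trans ltr01)// h1/=.
by rewrite lerBlDr lerDl invr_ge0 (le_trans ler01).
Qed.

(** The left end 1/(n+1) of the support tends to 0 while the factor [n] grows, so that the
supports stay to the right of 0 and the limit is the indicator of ]0, b[. *)
Lemma plateau_cvg (b t : R) :
  plateau n%:R (n.+1%:R^-1) b t @[n --> \oo] --> ((t \in `]0, b[)%:R : R).
Proof.
case: (boolP (t \in `]0, b[)) => tb; last first.
  apply: cvg_near_cst; apply: nearW => n.
  move: tb; rewrite in_itv/= negb_and -!leNgt => /orP[t0|bt]; rewrite /plateau /hump /pospart.
    rewrite (max_idPl _) ?expr0n ?mul0r ?mulr0 ?addr0 ?invr1 ?subrr//.
    by rewrite subr_le0 (le_trans t0).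
  rewrite [X in _ * X ^+ 2](max_idPl _) ?expr0n ?mulr0 ?addr0 ?invr1 ?subrr//.
  by rewrite subr_le0.
move: tb; rewrite in_itv/= => /andP[t0 tb].
(* For n large, the value of the hump at t is at least e. *)
pose e := (t / 2) ^+ 2 * (b - t) ^+ 2.
have e0 : 0 < e by rewrite mulr_gt0// exprn_gt0// ?divr_gt0// subr_gt0.
rewrite -[X in _ --> X]subr0; apply: cvgB; first exact: cvg_cst.
have t20 : 0 < t / 2 by rewrite divr_gt0.
apply/cvgr0Pnorm_le => d d0; near=> n.
have n1 : n.+1%:R^-1 <= t / 2.
  by apply: ltW; near: n; exact: (near_infty_natSinv_lt (PosNum t20)).
have nd : (e * d)^-1 <= n%:R.
  by near: n; exact: nbhs_infty_ger.
have p1 : t / 2 <= pospart (t - n.+1%:R^-1).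
  rewrite /pospart le_max; apply/orP; right.
  by move: n1; set q := n.+1%:R^-1; lra.
have p2 : b - t <= pospart (b - t) by rewrite /pospart le_max lexx orbT.
have bt0 : 0 <= b - t by rewrite subr_ge0 ltW.
have he : e <= hump n.+1%:R^-1 b t.
  apply: ler_pM; rewrite ?sqr_ge0//; apply: lerXn2r; rewrite ?nnegrE//.
  - exact: ltW.
  - by apply: le_trans p1; exact: ltW.
  - exact: le_trans p2.
have dn : 1 <= d * (n%:R * hump n.+1%:R^-1 b t).
  have ed0 : 0 < e * d by exact: mulr_gt0.
  rewrite -div1r ler_pdivrMr// in nd.
  apply: (le_trans nd); rewrite [leRHS]mulrCA ler_wpM2l// mulrC ler_wpM2l//.
  exact: ltW.
have h0 : 0 <= n%:R * hump n.+1%:R^-1 b t by rewrite mulr_ge0// hump_ge0.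
rewrite ger0_norm; last by rewrite invr_ge0 addr_ge0.
by rewrite -div1r ler_pdivrMr; nra.
Unshelve. all: by end_near. Qed.

End Plateaus.

(** * The fundamental lemma of the calculus of variations *)

Section DuBoisReymond.
Context {R : realType}.
Implicit Types (f g h F phi : R -> R).

Local Notation mu := (@lebesgue_measure R).
Local Notation I01 := (`[0%R, 1%R]%classic : set R).
Local Notation integrable01 f := (mu.-integrable I01 (EFin \o f)).

Lemma integral01_ereal f : integrable01 f ->
  (\int[mu]_(t in I01) (f t)%:E = (\int[mu]_(t in I01) f t)%:E)%E.
Proof. by move=> fi; rewrite fineK//; apply: integrable_fin_num => //; exact: measurable01. Qed.

(** Dominated convergence along the plateaus, with |h| as dominating function. *)
Lemma integral_initial_eq0 h (b : R) : integrable01 h ->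
  (forall phi, C1_test_function phi -> \int[mu]_(t in I01) (h t * phi t) = 0) ->
  0 < b < 1 -> \int[mu]_(t in `[0, b]) h t = 0.
Proof.
move=> hi h0 /andP[b0 b1].
pose p n t : R := plateau n%:R (n.+1%:R^-1) b t.
have tp n : C1_test_function (p n) by exact: plateau_test.
have cp n : {within I01, continuous (p n)}.
  apply: continuous_subspaceT => t; apply: differentiable_continuous.
  by apply/derivable1_diffP; have [] := tp n.
have hpi n : integrable01 (fun t => h t * p n t) by exact: integrable01M.
have hcvg t : I01 t ->
    (h t * p n t)%:E @[n --> \oo] --> (h t * (t \in `]0, b[)%:R)%:E.
  move=> _; apply: cvg_EFin; first exact: nearW.
  by apply: cvgM; [exact: cvg_cst|exact: plateau_cvg].
have mp n : measurable_fun I01 (fun t => (h t * p n t)%:E).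
  exact: measurable_int (hpi n).
have [||||_ _ H] := @dominated_convergence _ _ _ mu I01 measurable01
  (fun n t => (h t * p n t)%:E) (fun t => (h t * (t \in `]0, b[)%:R)%:E)
  (fun t => `|h t|%:E) mp.
- exact: (emeasurable_fun_cvg _ _ mp hcvg).
- by apply: aeW => t /hcvg.
- exact: integrable_norm.
- apply: aeW => t n It; rewrite lee_fin normrM ler_piMr//.
  have /andP[p0 p1] := @plateau_bound _ n%:R n.+1%:R^-1 b t (ler0n _ _).
  by rewrite ger0_norm.
have {}H : (\int[mu]_(t in I01) (h t * (t \in `]0, b[)%:R)%:E = 0)%E.
  apply/esym/(cvg_unique _ _ H) => //.
  apply: cvg_near_cst; apply: nearW => n.
  by rewrite /= integral01_ereal// h0.
have s : I01 `&` `]0, b[ = `]0, b[%classic :> set R.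
  apply/setIidPr => t /=; rewrite !in_itv/= => /andP[t0 tb].
  by rewrite !ltW// (lt_trans tb).
have hs (j : interval R) : [set` j] `<=` I01 -> mu.-integrable [set` j] (EFin \o h).
  by move=> sj; apply: integrableS hi => //; exact: measurable_itv.
rewrite -Rintegral_itv_bndo_bndc -?Rintegral_itv_obnd_cbnd.
- rewrite -s Rintegral_mkcondr; rewrite /Rintegral -[RHS]/(fine 0%E) -H.
  congr fine; apply: eq_integral => t _; rewrite patchE mem_setE.
  by case: ifPn => _; rewrite ?mulr1 ?mulr0.
- by apply: hs; rewrite -s; exact: subIsetl.
- apply: hs => t /=; rewrite !in_itv/= => /andP[t0 tb].
  by rewrite t0 ltW// (lt_trans tb).
Qed.

(** The primitive of [h] vanishes on ]0, 1[ by the preceding lemma, and almost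
everywhere its derivative is [h] by Lebesgue's differentiation theorem. *)
Lemma fundamental_lemma h : integrable01 h ->
  (forall phi, C1_test_function phi -> \int[mu]_(t in I01) (h t * phi t) = 0) ->
  {ae mu, forall t, I01 t -> h t = 0}.
Proof.
move=> hi h0; pose k := h \_ I01.
have ki : mu.-integrable setT (EFin \o k).
  by rewrite -restrict_EFin; apply/integrable_restrict; rewrite ?setTI//; exact: measurable01.
have lk := integrable_locally measurable01 hi.
have kiy y : mu.-integrable [set` Interval (BLeft (0:R)) (BRight y)] (EFin \o k).
  by apply: integrableS ki => //; exact: measurable_itv.
have ng : mu.-negligible [set (0:R); 1].
  by apply: negligibleU; apply/negligibleP => //; exact: lebesgue_measure_set1.
have n01 : \forall t \ae mu, ~ [set (0:R); 1] t.
  by apply: negligibleS ng => t /contrapT.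
have := FTC1 kiy lk; move: n01.
apply: filterS2; first exact: (ae_filter_ringOfSetsType mu).
move=> t /not_orP[t0 t1] Pt.
rewrite /= in_itv/= => /andP[t0' t1'].
have {}t0 : 0 < t by rewrite lt_neqAle t0' andbT eq_sym; exact/eqP.
have {}t1 : t < 1 by rewrite lt_neqAle t1' andbT; exact/eqP.
have [|dF] := Pt; first by rewrite lte_fin.
have -> : k t = h t by rewrite /k patchE mem_set//= in_itv/= t0' t1'.
move=> <-; rewrite derive1E.
rewrite (@near_eq_derive _ _ _ _ (cst 0)) ?derive_cst//.
near=> u.
have u0 : 0 < u by near: u; exact: lt_nbhsr.
have u1 : u < 1 by near: u; exact: lt_nbhsl.
rewrite -[RHS](@integral_initial_eq0 h u hi h0) ?u0//.
apply: eq_Rintegral => s; rewrite inE/= in_itv/= => /andP[s0 su].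
by rewrite /k patchE mem_set//= in_itv/= s0 (le_trans su)// ltW.
Unshelve. all: by end_near. Qed.

(** The vanishing of the mean makes the primitive vanish to the right of the support. *)
Lemma test_function_primitive th (a b : R) : continuous th -> 0 < a -> b < 1 ->
  (forall t, t \notin `[a, b] -> th t = 0) -> \int[mu]_(t in I01) th t = 0 ->
  exists2 phi, C1_test_function phi & derive1 phi = th.
Proof.
move=> cth a0 b1 th0 ith.
pose phi (u : R) : R := \int[mu]_(s in `[- 1, u]) th s.
have phil u : u < a -> phi u = 0.
  move=> ua; rewrite /phi (@eq_Rintegral _ _ _ _ _ (cst 0)).
    by rewrite Rintegral_cst ?mul0r//; exact: measurable_itv.
  move=> s; rewrite inE/= in_itv/= => /andP[_ su]; apply: th0.
  by rewrite in_itv/= negb_and -ltNge (le_lt_trans su ua).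
have phir u : b < u -> phi u = 0.
  move=> bu; rewrite /phi -ith Rintegral_mkcond [RHS]Rintegral_mkcond.
  apply: eq_Rintegral => s _; rewrite !patchE.
  have [sab|/th0 ->] := boolP (s \in `[a, b]); last by rewrite !if_same.
  move: sab; rewrite in_itv/= => /andP[sa sb].
  rewrite !mem_set//= in_itv/=; apply/andP; split; lra.
have [||tp dp] := @C1_test_functionI _ phi th a b _ cth a0 b1.
- move=> t; have [t1|t1] := ltP (- 1) t; first exact: is_derive_primitive.
  have ta : t < a by lra.
  rewrite th0; last by rewrite in_itv/= negb_and -ltNge ta.
  apply: (@near_eq_is_derive _ _ _ (cst 0)).
  near=> u; rewrite phil//; near: u; exact: lt_nbhsl.
- move=> t; rewrite in_itv/= negb_and -!ltNge => /orP[]; [exact: phil|exact: phir].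
- by exists phi.
Unshelve. all: by end_near. Qed.

Lemma continuous_test phi : C1_test_function phi -> continuous phi.
Proof.
move=> [dphi _ _] t; apply: differentiable_continuous.
exact/derivable1_diffP.
Qed.

Lemma integrable01_test phi : C1_test_function phi -> integrable01 phi.
Proof. by move=> /continuous_test; exact: integrable01_continuous. Qed.

(** Otherwise the fundamental lemma would apply to the constant function 1. *)
Lemma test_function_mass :
  exists2 rho : R -> R, C1_test_function rho & \int[mu]_(t in I01) rho t != 0.
Proof.
apply: contrapT => nrho; have := @fundamental_lemma (cst 1).
case.
- by apply: integrable01_continuous => t; exact: cvg_cst.
- move=> phi tphi; apply: contrapT => /eqP H; apply: nrho; exists phi => //.
  by apply: contra_neq H; under [in X in _ -> X]eq_Rintegral do rewrite mul1r.
- move=> N [mN N0 sN].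
  have : mu I01 = 0%E.
    apply: (subset_measure0 measurable01 mN _ N0).
    by move=> t It; apply: sN => /= /(_ It) /eqP; rewrite oner_eq0.
  by rewrite lebesgue_measure01 => /eqP; rewrite eqe oner_eq0.
Qed.

(** Any test function [psi] becomes the derivative of a test function once a multiple
of a fixed one of nonzero mass is subtracted to make its mean zero.  The
hypothesis then says that [f] minus a constant is orthogonal to [psi]. *)
Lemma du_bois_reymond f : integrable01 f ->
  (forall phi, C1_test_function phi ->
    \int[mu]_(t in I01) (f t * derive1 phi t) = 0) ->
  exists c, {ae mu, forall t, I01 t -> f t = c}.
Proof.
move=> fi f0; have [rho trho m0] := test_function_mass.
set m := \int[mu]_(t in I01) rho t in m0.
pose c := (\int[mu]_(t in I01) (f t * rho t)) / m; exists c.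
have fci : integrable01 (fun t => f t - c).
  by apply: integrable01B => //; apply: integrable01_continuous => t; exact: cvg_cst.
suff : {ae mu, forall t, I01 t -> f t - c = 0}.
  apply: filterS; first exact: (ae_filter_ringOfSetsType mu).
  by move=> t H /H/eqP; rewrite subr_eq0 => /eqP.
apply: fundamental_lemma => // psi tpsi.
pose d := (\int[mu]_(t in I01) psi t) / m.
have ftest p : C1_test_function p -> integrable01 (fun t => f t * p t).
  move=> tp; apply: integrable01M => //; apply: continuous_subspaceT.
  exact: continuous_test.
have [a1 [b1 [a10 b11 s1]]] : exists a b : R,
    [/\ 0 < a, b < 1 & forall t, t \notin `[a, b] -> psi t = 0] by case: tpsi.
have [a2 [b2 [a20 b21 s2]]] : exists a b : R,
    [/\ 0 < a, b < 1 & forall t, t \notin `[a, b] -> rho t = 0] by case: trho.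
have drho : integrable01 (fun t => d * rho t).
  by apply: integrable01Z; exact: integrable01_test.
have [|||||phi tphi dphi] := @test_function_primitive
  (fun t => psi t - d * rho t) (Num.min a1 a2) (Num.max b1 b2).
- move=> t; apply: cvgB; first exact: continuous_test.
  by apply: cvgM; [exact: cvg_cst|exact: continuous_test].
- by rewrite lt_min a10.
- by rewrite gt_max b11.
- move=> t; rewrite in_itv/= negb_and -!ltNge lt_min gt_max => tab.
  rewrite s1 ?s2 ?mulr0 ?subr0// in_itv/= negb_and -!ltNge;
    by case/orP: tab => /andP[t1 t2]; rewrite ?t1 ?t2 ?orbT.
- rewrite RintegralB//; [|exact: integrable01_test].
  rewrite RintegralZl//; [|exact: integrable01_test].
  by rewrite /d divfK// subrr.
have := f0 _ tphi; rewrite dphi.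
have -> : \int[mu]_(t in I01) (f t * (psi t - d * rho t)) =
    \int[mu]_(t in I01) (f t * psi t) - d * \int[mu]_(t in I01) (f t * rho t).
  rewrite -RintegralZl//; [|exact: ftest].
  rewrite -RintegralB//; [|exact: ftest|].
    by apply: eq_Rintegral => t _; ring.
  by apply: integrable01Z; exact: ftest.
move=> H; transitivity (\int[mu]_(t in I01) (f t * psi t - c * psi t)).
  by apply: eq_Rintegral => t _; rewrite mulrBl.
rewrite RintegralB//; [|exact: ftest|]; last first.
  by apply: integrable01Z; exact: integrable01_test.
rewrite RintegralZl//; [|exact: integrable01_test].
apply/eqP; rewrite subr_eq0; move/eqP: H; rewrite subr_eq0 => /eqP ->.
by apply/eqP; rewrite /c /d -/m; ring.
Qed.

End DuBoisReymond.

(** * Regularity of weak solutions in one variable *)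

Section Regularity.
Context {R : realType}.
Implicit Types (f g h F phi w : R -> R).

Local Notation mu := (@lebesgue_measure R).
Local Notation I01 := (`[0%R, 1%R]%classic : set R).
Local Notation integrable01 f := (mu.-integrable I01 (EFin \o f)).

Lemma ae_eq_Rintegral01 f g : integrable01 f -> integrable01 g ->
  {ae mu, forall t, I01 t -> f t = g t} ->
  \int[mu]_(t in I01) f t = \int[mu]_(t in I01) g t.
Proof.
move=> fi gi fg; congr fine; apply: ae_eq_integral.
- exact: measurable01.
- exact: measurable_int fi.
- exact: measurable_int gi.
- move: fg; apply: filterS; first exact: (ae_filter_ringOfSetsType mu).
  by move=> t H /H ->.
Qed.

(** If the function did not vanish at a point, it would not vanish on an interval of
positive length around it. *)
Lemma continuous_ae_eq0 f : {within I01, continuous f} ->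
  {ae mu, forall t, I01 t -> f t = 0} -> forall t, I01 t -> f t = 0.
Proof.
move=> /subspace_continuousP cf [N [mN N0 sN]] t It; apply: contrapT => /eqP ft0.
have := cf t It.
move/cvgrPdist_lt => /(_ `|f t|); rewrite normr_gt0 => /(_ ft0).
move=> [e /= e0 He].
(* The ball around t is cut down to the unit interval, as t may be an endpoint. *)
pose l := Num.max 0 (t - e); pose r := Num.min 1 (t + e).
have lr : l < r.
  move: It; rewrite /= in_itv/= => /andP[t0 t1].
  by rewrite /l /r gt_max !lt_min; apply/andP; split; apply/andP; split; lra.
have JN : `]l, r[%classic `<=` N.
  move=> u; rewrite /= in_itv/= /l /r gt_max lt_min => /andP[/andP[u0 tu] /andP[u1 ut]].
  have Iu : I01 u by rewrite /= in_itv/= !ltW.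
  apply: sN => /= /(_ Iu) fu0.
  have : `|f t - f u| < `|f t|.
    by apply: He => //=; rewrite ltr_norml; apply/andP; split; lra.
  by rewrite fu0 subr0 ltxx.
have : mu `]l, r[%classic = 0%E by apply: (subset_measure0 _ mN JN N0).
rewrite lebesgue_measure_itv/= lte_fin lr -EFinB => /eqP.
by rewrite eqe subr_eq0 => /eqP rl; rewrite rl ltxx in lr.
Qed.

(** Precomposing with this retraction onto [0,1] extends a function that is only
continuous on [0,1] to a continuous function on the line. *)
Definition clamp01 (t : R) : R := Num.max 0 (Num.min 1 t).

Lemma clamp01_id (t : R) : 0 <= t <= 1 -> clamp01 t = t.
Proof. by move=> /andP[t0 t1]; rewrite /clamp01 (min_idPr t1) (max_idPr t0). Qed.

Lemma clamp01_itv (t : R) : I01 (clamp01 t).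
Proof. by rewrite /= in_itv/= /clamp01 le_max lexx/= ge_max ler01 ge_min lexx. Qed.

Lemma continuous_clamp01 : continuous clamp01.
Proof.
move=> t; apply: continuous_max; first exact: cvg_cst.
by apply: continuous_min; [exact: cvg_cst|exact: cvg_id].
Qed.

Lemma continuous_comp_clamp01 (T : topologicalType) (f : R -> T) :
  {within I01, continuous f} -> continuous (fun t => f (clamp01 t)).
Proof.
move=> /subspace_continuousP cf t.
apply: (@cvg_comp _ _ _ clamp01 f _ _ _ _ (cf _ (clamp01_itv t))) => P.
rewrite /within/= => HP.
have H : \forall u \near t, I01 (clamp01 u) -> P (clamp01 u) := continuous_clamp01 HP.
suff : \forall u \near t, P (clamp01 u) by [].
by apply: filterS H => u; apply; exact: clamp01_itv.
Qed.

Lemma is_derive_continuous f (df t : R) : is_derive t (1 : R) f df -> {for t, continuous f}.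
Proof.
move=> H; apply: differentiable_continuous; apply/derivable1_diffP.
exact: ex_derive.
Qed.

(** With [W] a primitive of [w], integration by parts turns the hypothesis into
int (g + K W) phi' = 0, and the lemma of du Bois-Reymond applies. *)
Lemma weak_euler_lagrange g w (K : R) : integrable01 g -> continuous w ->
  (forall phi, C1_test_function phi ->
    \int[mu]_(t in I01) (g t * derive1 phi t) =
    K * \int[mu]_(t in I01) (w t * phi t)) ->
  exists p : R -> R, (forall t : R, 0 <= t <= 1 -> is_derive t (1 : R) p (- (K * w t))) /\
    {ae mu, forall t, I01 t -> g t = p t}.
Proof.
move=> gi cw EL; pose W (u : R) : R := \int[mu]_(s in `[- 1, u]) w s.
have dW (t : R) : 0 <= t <= 1 -> is_derive t (1 : R) W (w t).
  by move=> /andP[t0 _]; apply: is_derive_primitive => //; lra.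
have cW : {within I01, continuous W}.
  apply/subspace_continuousP => t It; apply: cvg_within_filter.
  by apply: (@is_derive_continuous _ (w t)); apply: dW; rewrite /= in_itv in It.
have KWi : integrable01 (fun t => K * W t).
  by apply: integrable01Z; exact: integrable01_within.
have [||c gc] := @du_bois_reymond _ (fun t => g t + K * W t).
- exact: integrable01D.
- move=> phi tphi; have cdphi : {within I01, continuous (derive1 phi)}.
    by apply: continuous_subspaceT; case: tphi.
  transitivity (\int[mu]_(t in I01) (g t * derive1 phi t + K * (W t * derive1 phi t))).
    by apply: eq_Rintegral => t _; rewrite mulrDl mulrA.
  have Wi : integrable01 (fun t => W t * derive1 phi t).
    by apply: integrable01M => //; exact: integrable01_within.
  rewrite RintegralD//; [|exact: integrable01M|exact: integrable01Z].
  rewrite EL// RintegralZl// (integration_by_parts_test dW _ tphi).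
    by rewrite mulrN subrr.
  exact: continuous_subspaceT.
- exists (fun t => c - K * W t); split.
    move=> t t01; have := dW t t01 => dWt.
    have := is_deriveB (is_derive_cst c t (1:R)) (is_deriveZ K dWt).
    by move/is_derive_eq; apply; rewrite sub0r.
  move: gc; apply: filterS; first exact: (ae_filter_ringOfSetsType mu).
  by move=> t H /H <-; rewrite addrK.
Qed.

(** The difference of [f] and a primitive of [p] has weak derivative zero, hence is
almost everywhere constant, hence constant by continuity. *)
Lemma weak_primitive f g p : {within I01, continuous f} -> integrable01 g ->
  (forall phi, C1_test_function phi ->
    \int[mu]_(t in I01) (f t * derive1 phi t) = - \int[mu]_(t in I01) (g t * phi t)) ->
  {within I01, continuous p} -> {ae mu, forall t, I01 t -> g t = p t} ->
  exists F, (forall t : R, 0 <= t <= 1 -> is_derive t (1 : R) F (p t)) /\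
    forall t, I01 t -> f t = F t.
Proof.
move=> cf gi fg cp gp; pose q t := p (clamp01 t).
have cq : continuous q by exact: continuous_comp_clamp01.
pose Q (u : R) : R := \int[mu]_(s in `[- 1, u]) q s.
have dQ (t : R) : 0 <= t <= 1 -> is_derive t (1 : R) Q (q t).
  by move=> /andP[t0 _]; apply: is_derive_primitive => //; lra.
have cQ : {within I01, continuous Q}.
  apply/subspace_continuousP => t It; apply: cvg_within_filter.
  by apply: (@is_derive_continuous _ (q t)); apply: dQ; rewrite /= in_itv in It.
have cfQ : {within I01, continuous (fun t => f t - Q t)}.
  by move=> t; apply: cvgB; [exact: cf|exact: cQ].
have [||c fc] := @du_bois_reymond _ (fun t => f t - Q t).
- exact: integrable01_within.
- move=> phi tphi; have cdphi : {within I01, continuous (derive1 phi)}.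
    by apply: continuous_subspaceT; case: tphi.
  have cphi : {within I01, continuous phi}.
    by apply: continuous_subspaceT; exact: continuous_test.
  transitivity (\int[mu]_(t in I01) (f t * derive1 phi t - Q t * derive1 phi t)).
    by apply: eq_Rintegral => t _; rewrite mulrBl.
  rewrite RintegralB//;
    [|by apply: integrable01M => //; exact: integrable01_within..].
  rewrite fg// (integration_by_parts_test dQ _ tphi); last exact: continuous_subspaceT.
  rewrite opprK addrC; apply/eqP; rewrite subr_eq0; apply/eqP/ae_eq_Rintegral01.
  + by apply: integrable01M => //; exact: integrable01_continuous.
  + exact: integrable01M.
  + move: gp; apply: filterS; first exact: (ae_filter_ringOfSetsType mu).
    by move=> t H It; rewrite H// /q clamp01_id//; rewrite /= in_itv in It.
- exists (fun t => Q t + c); split.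
    move=> t t01; have := dQ t t01; rewrite /q clamp01_id// => dQt.
    have := is_deriveD dQt (is_derive_cst c t (1:R)).
    by move/is_derive_eq; apply; rewrite addr0.
  move=> t It; have := @continuous_ae_eq0 (fun t => f t - Q t - c) _ _ t It.
  move=> H; apply/eqP; rewrite addrC -subr_eq -subr_eq0; apply/eqP; apply: H.
    by move=> u; apply: cvgB; [exact: cfQ|exact: cvg_cst].
  move: fc; apply: filterS; first exact: (ae_filter_ringOfSetsType mu).
  by move=> u H /H ->; rewrite subrr.
Qed.

End Regularity.

(** * The action of a Sobolev path *)

Section Action.
Context {R : realType} {n : nat}.
Implicit Types (x y g h : R -> 'rV[R]_n) (U : 'rV[R]_n -> R).

Local Notation mu := (@lebesgue_measure R).
Local Notation I01 := (`[0%R, 1%R]%classic : set R).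
Local Notation integrable01 f := (mu.-integrable I01 (EFin \o f)).

(** Chain rule along a curve, with the differential expanded in partial derivatives. *)
Lemma is_derive_comp_rV U x (t : R) (v : 'rV[R]_n) :
  differentiable U (x t) -> is_derive t (1 : R) x v ->
  is_derive t (1 : R) (U \o x) (\sum_i v 0 i * partial i U (x t)).
Proof.
move=> dU dx; have dxt : differentiable x t.
  by apply/derivable1_diffP; exact: ex_derive.
have dUx : differentiable (U \o x) t by exact: differentiable_comp.
apply: DeriveDef; first exact/derivable1_diffP.
rewrite deriveE// diff_comp//= -(deriveE _ dxt) derive_val.
rewrite [in LHS](row_sum_delta v) linear_sum; apply: eq_bigr => i _.
by rewrite linearZ/= -deriveE.
Qed.

Lemma is_derive_row (f : 'I_n -> R -> R) (df : 'I_n -> R) (t : R) :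
  (forall i, is_derive t (1 : R) (f i) (df i)) ->
  is_derive t (1 : R) (fun s => \row_i f i s) (\row_i df i).
Proof.
move=> Df; have := @is_derive_sum _ _ _ n
  (fun i s => f i s *: (delta_mx 0 i : 'rV[R]_n)) t 1
  (fun i => df i *: (delta_mx 0 i : 'rV[R]_n)).
rewrite (row_sum_delta (\row_i df i)).
have -> : \sum_(i < n) (fun s : R => f i s *: (delta_mx 0 i : 'rV[R]_n)) =
    (fun s => \row_i f i s).
  apply/funext => s; rewrite fct_sumE [RHS]row_sum_delta.
  by apply: eq_bigr => i _; rewrite mxE.
move=> H; apply: (is_derive_eq (H _)); last first.
  by apply: eq_bigr => i _; rewrite mxE.
move=> i; have := Df i => Dfi.
have dfi : differentiable (f i) t by apply/derivable1_diffP; exact: ex_derive.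
have dd := differentiableZl (delta_mx 0 i : 'rV[R]_n) dfi.
apply: DeriveDef; first exact/derivable1_diffP.
rewrite deriveE// diffZl//= -deriveE// derive_val//.
Qed.

Lemma continuous_ball_bounded (f : 'rV[R]_n -> R) (C : R) : continuous f ->
  exists B, forall z, `|z| <= C -> `|f z| <= B.
Proof.
move=> cf; pose K : set 'rV[R]_n := [set z | `|z| <= C].
have cK : compact K.
  apply: bounded_closed_compact.
    exists C; split; first exact: num_real.
    by move=> M CM z /le_trans; apply; exact: ltW.
  have -> : K = (fun z : 'rV[R]_n => `|z|) @^-1` [set r | r <= C] by [].
  apply: closed_comp; last exact: closed_le.
  by move=> z _; exact: norm_continuous.
have /compact_bounded[M [_ HM]] :=
  @continuous_compact _ _ f K (continuous_subspaceT cf) cK.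
by exists (M + 1) => z zC; apply: HM; [rewrite ltrDl|exists z].
Qed.

Lemma within_continuous_coord x (i : 'I_n) : {within I01, continuous x} ->
  {within I01, continuous (fun t => x t 0 i)}.
Proof.
move=> cx t; apply: (@cvg_comp _ _ _ x (fun z : 'rV[R]_n => z 0 i) _ _ _ (cx t)).
exact: coord_continuous.
Qed.

Lemma within_continuous_comp U x : continuous U -> {within I01, continuous x} ->
  {within I01, continuous (fun t => U (x t))}.
Proof.
by move=> cU cx t; apply: (@cvg_comp _ _ _ x U _ _ _ (cx t)); exact: cU.
Qed.

Lemma L2_weak g : (exists x, is_weak_derivative x g) -> forall i, L2 (fun t => g t 0 i).
Proof. by move=> [x H] i; have [] := H i. Qed.

Lemma integrable01_sqnorm g : (forall i, L2 (fun t => g t 0 i)) ->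
  integrable01 (fun t => sqnorm (g t)).
Proof.
move=> Lg; apply: integrable01_sum => i; have [_] := Lg i.
by apply: integrable01_eq => t _; rewrite expr2.
Qed.

(** The fundamental lemma, applied to each coordinate of the difference. *)
Lemma weak_derivative_unique x g h : is_weak_derivative x g ->
  is_weak_derivative x h -> {ae mu, forall t, I01 t -> g t = h t}.
Proof.
move=> xg xh.
have H i : {ae mu, forall t, I01 t -> g t 0 i - h t 0 i = 0}.
  have [gL2 gw] := xg i; have [hL2 hw] := xh i.
  have [gi hi] := (integrable01_L2 gL2, integrable01_L2 hL2).
  apply: fundamental_lemma; first exact: integrable01B.
  move=> phi tphi; have cphi := continuous_test tphi.
  under eq_Rintegral do rewrite mulrBl.
  rewrite RintegralB//; first (apply/eqP; rewrite subr_eq0 -eqr_opp -gw// -hw//).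
  - by apply: integrable01M => //; exact: continuous_subspaceT.
  - by apply: integrable01M => //; exact: continuous_subspaceT.
have : \forall t \ae mu, forall i, I01 t -> g t 0 i - h t 0 i = 0.
  by apply: filter_forall H; exact: (ae_filter_ringOfSetsType mu).
apply: filterS; first exact: (ae_filter_ringOfSetsType mu).
move=> t Ht It; apply/rowP => i; apply/eqP; rewrite -subr_eq0; apply/eqP.
exact: Ht.
Qed.

Lemma weak_derivativeP x g : is_weak_derivative x g ->
  is_weak_derivative x (weak_derivative x).
Proof. by move=> xg; apply: (@getPex _ (is_weak_derivative x)); exists g. Qed.

Lemma weak_derivative_ae x g : is_weak_derivative x g ->
  {ae mu, forall t, I01 t -> weak_derivative x t = g t}.
Proof. by move=> xg; exact: (weak_derivative_unique (weak_derivativeP xg) xg). Qed.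

(** The chosen weak derivative may be replaced by any other one, and the kinetic term is
quadratic in the velocity, so that [T] comes out of the integral.  The formula
also holds for [T = 0], where both sides vanish. *)
Lemma action_lagrangian U (k : R) x g (T : R) : continuous U ->
  {within I01, continuous x} -> is_weak_derivative x g ->
  action (lagrangian U) k x T =
  T * (2^-1 * T ^- 2 * (\int[mu]_(t in I01) sqnorm (g t)) -
       \int[mu]_(t in I01) U (x t) + k).
Proof.
move=> cU cx xg; rewrite /action; congr (_ * _).
have Ux := integrable01_within (within_continuous_comp cU cx).
have sqZ (c : R) (v : 'rV[R]_n) : sqnorm (c *: v) = c ^+ 2 * sqnorm v.
  rewrite /sqnorm /dot mulr_sumr; apply: eq_bigr => i _.
  by rewrite !mxE; ring.
have Gi h : is_weak_derivative x h -> integrable01 (fun t => sqnorm (h t)).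
  by move=> xh; apply: integrable01_sqnorm; apply: L2_weak; exists x.
have ki : integrable01 (cst k).
  by apply: integrable01_continuous => t; exact: cvg_cst.
have Fi h : is_weak_derivative x h ->
    integrable01 (fun t => 2^-1 * T ^- 2 * sqnorm (h t) - U (x t) + k).
  move=> xh; apply: integrable01D => //; apply: integrable01B => //.
  by apply: integrable01Z; exact: Gi.
transitivity (\int[mu]_(t in I01) (2^-1 * T ^- 2 * sqnorm (g t) - U (x t) + k)).
  have wx := weak_derivativeP xg.
  transitivity (\int[mu]_(t in I01)
    (2^-1 * T ^- 2 * sqnorm (weak_derivative x t) - U (x t) + k)).
    by apply: eq_Rintegral => t _; rewrite /lagrangian sqZ exprVn mulrA.
  apply: ae_eq_Rintegral01; [exact: Fi|exact: Fi|].
  have := weak_derivative_ae xg.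
  apply: filterS; first exact: (ae_filter_ringOfSetsType mu).
  by move=> t H It; rewrite H.
rewrite RintegralD//; last first.
  by apply: integrable01B => //; apply: integrable01Z; exact: Gi.
rewrite RintegralB//; last by apply: integrable01Z; exact: Gi.
rewrite RintegralZl//; last exact: Gi.
by congr (_ + _); exact: integral01_cst.
Qed.

End Action.

(** * Variations in a coordinate direction *)

Section Variations.
Context {R : realType} {n : nat}.
Implicit Types (x y g h : R -> 'rV[R]_n) (U : 'rV[R]_n -> R).

Local Notation mu := (@lebesgue_measure R).
Local Notation I01 := (`[0%R, 1%R]%classic : set R).
Local Notation integrable01 f := (mu.-integrable I01 (EFin \o f)).

(** Variations of a single coordinate are enough to obtain the Euler-Lagrange
system. *)
Definition direction (phi : R -> R) (i : 'I_n) (t : R) : 'rV[R]_n := phi t *: basis_vec i.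

Lemma directionE phi (i j : 'I_n) t : direction phi i t 0 j = phi t * (j == i)%:R.
Proof. by rewrite /direction /basis_vec !mxE eqxx. Qed.

Lemma continuous_direction (phi : R -> R) (i : 'I_n) : continuous phi ->
  continuous (direction phi i).
Proof. by move=> cphi t; apply: cvgZr_tmp; exact: cphi. Qed.

Lemma is_weak_derivativeD x y g h (s : R) : {within I01, continuous x} ->
  {within I01, continuous y} -> is_weak_derivative x g -> is_weak_derivative y h ->
  is_weak_derivative (fun t => x t + s *: y t) (fun t => g t + s *: h t).
Proof.
move=> cx cy xg yh i; have [gL gw] := xg i; have [hL hw] := yh i.
have [gi hi] := (integrable01_L2 gL, integrable01_L2 hL).
split.
  have H := L2D gL (L2Z s hL).
  by rewrite (_ : (fun _ => _) = (fun t => g t 0 i + s * h t 0 i))//;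
    apply/funext => t; rewrite !mxE.
move=> phi tphi.
have cphi : {within I01, continuous phi}.
  by apply: continuous_subspaceT; exact: continuous_test.
have cdphi : {within I01, continuous (derive1 phi)}.
  by apply: continuous_subspaceT; case: tphi.
have xi := integrable01_within (@within_continuous_coord _ _ x i cx).
have yi := integrable01_within (@within_continuous_coord _ _ y i cy).
transitivity (\int[mu]_(t in I01) (x t 0 i * derive1 phi t + s * (y t 0 i * derive1 phi t))).
  by apply: eq_Rintegral => t _; rewrite !mxE; ring.
rewrite RintegralD//; [|exact: integrable01M|by apply: integrable01Z; exact: integrable01M].
rewrite RintegralZl//; last exact: integrable01M.
rewrite gw// hw// mulrN -opprD; congr (- _).
rewrite -RintegralZl//; last exact: integrable01M.
rewrite -RintegralD//; [|exact: integrable01M|by apply: integrable01Z; exact: integrable01M].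
by apply: eq_Rintegral => t _; rewrite !mxE; ring.
Qed.

Lemma weak_derivative_direction (phi : R -> R) (i : 'I_n) : C1_test_function phi ->
  is_weak_derivative (direction phi i) (direction (derive1 phi) i).
Proof.
move=> tphi j; have [dphi cdphi _] := tphi; split.
  have H := L2Z (j == i)%:R (L2_continuous cdphi).
  by rewrite (_ : (fun _ => _) = (fun t => (j == i)%:R * derive1 phi t))//;
    apply/funext => t; rewrite directionE mulrC.
move=> psi tpsi.
have cpsi : {within I01, continuous psi}.
  by apply: continuous_subspaceT; exact: continuous_test.
have cdpsi : {within I01, continuous (derive1 psi)}.
  by apply: continuous_subspaceT; case: tpsi.
transitivity ((j == i)%:R * \int[mu]_(t in I01) (phi t * derive1 psi t)).
  rewrite -RintegralZl//; last by apply: integrable01M => //; exact: integrable01_test.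
  by apply: eq_Rintegral => t _; rewrite directionE; ring.
have dp (t : R) : 0 <= t <= 1 -> is_derive t (1 : R) phi (derive1 phi t).
  by move=> _; rewrite derive1E; exact: derivableP.
have cdphi1 : {within I01, continuous (derive1 phi)} by exact: continuous_subspaceT.
have H := integration_by_parts_test dp cdphi1 tpsi.
rewrite H mulrN; congr (- _).
rewrite -RintegralZl//; last by apply: integrable01M => //; exact: integrable01_continuous.
by apply: eq_Rintegral => t _; rewrite directionE; ring.
Qed.

Lemma direction_W12 (phi : R -> R) (i : 'I_n) : C1_test_function phi ->
  W12_bc 0 0 (direction phi i).
Proof.
move=> tphi; have [phi0 phi1] := test_endpoints tphi.
split; [split|by rewrite /direction phi0 scale0r|by rewrite /direction phi1 scale0r].
  by apply: continuous_subspaceT; apply: continuous_direction; exact: continuous_test.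
by exists (direction (derive1 phi) i); exact: weak_derivative_direction.
Qed.

Lemma zero_W12 : W12_bc 0 0 (fun _ : R => 0 : 'rV[R]_n).
Proof.
split => //; split; first by move=> t; exact: cvg_cst.
exists (fun=> 0) => i; split.
  have : L2 (cst (0 : R)) by apply: L2_continuous => t; exact: cvg_cst.
  by rewrite (_ : (fun _ => _) = cst 0)//; apply/funext => t; rewrite mxE.
move=> phi _; transitivity (0 : R); last (symmetry; apply/eqP; rewrite oppr_eq0; apply/eqP).
all: rewrite (@eq_Rintegral _ _ _ _ _ (cst 0)); [exact: integral01_cst|].
all: by move=> t _; rewrite mxE mul0r.
Qed.

Lemma is_derive_scalel (v : 'rV[R]_n) (s : R) :
  is_derive s (1 : R) (fun r : R => r *: v) v.
Proof.
have [d e] := is_diff_scalel s v.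
by apply: DeriveDef; [exact/derivable1_diffP|rewrite deriveE// e scale1r].
Qed.

(** Differentiation under the integral: for |s| <= 1 the perturbed path stays in a
fixed ball, where the partial derivative of [U] is bounded. *)
Lemma is_derive_potential U x (phi : R -> R) (i : 'I_n) :
  (forall z, differentiable U z) -> continuous (partial i U) ->
  {within I01, continuous x} -> continuous phi ->
  is_derive (0 : R) (1 : R)
    (fun s => \int[mu]_(t in I01) U (x t + s *: direction phi i t))
    (\int[mu]_(t in I01) (partial i U (x t) * phi t)).
Proof.
move=> dU cdU cx cphi.
have cU : continuous U by move=> z; exact: differentiable_continuous.
have cd : {within I01, continuous (direction phi i)}.
  by apply: continuous_subspaceT; exact: continuous_direction.
have cxs (s : R) : {within I01, continuous (fun t => x t + s *: direction phi i t)}.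
  move=> t; apply: cvgD; first exact: cx.
  by apply: cvgZl_tmp; exact: cd.
have dline (s t : R) : is_derive s (1 : R) (fun r => U (x t + r *: direction phi i t))
    (partial i U (x t + s *: direction phi i t) * phi t).
  have dl : is_derive s (1 : R) (fun r : R => x t + r *: direction phi i t) (direction phi i t).
    have := is_deriveD (is_derive_cst (x t) s (1 : R)) (is_derive_scalel (direction phi i t) s).
    by move/is_derive_eq; apply; rewrite add0r.
  have := @is_derive_comp_rV _ _ U _ s _ (dU _) dl.
  move/is_derive_eq; apply; rewrite (bigD1 i)//= big1 ?addr0.
    by rewrite directionE eqxx mulr1 mulrC.
  by move=> j ji; rewrite directionE (negPf ji) mulr0 mul0r.
have [M HM] : exists M, forall t, I01 t -> `|x t| <= M.
  have /compact_bounded[M [_ HM]] := continuous_compact cx (@segment_compact _ 0 1).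
  by exists (M + 1) => t It; apply: HM; [rewrite ltrDl|exists t].
have [N HN] : exists N, forall t, I01 t -> `|direction phi i t| <= N.
  have /compact_bounded[N [_ HN]] := continuous_compact cd (@segment_compact _ 0 1).
  by exists (N + 1) => t It; apply: HN; [rewrite ltrDl|exists t].
have [B HB] := @continuous_ball_bounded _ _ (partial i U) (M + N) cdU.
have fi (s : R) : integrable01 (fun t => U (x t + s *: direction phi i t)).
  exact: integrable01_within (within_continuous_comp cU (cxs s)).
pose f s t := U (x t + s *: direction phi i t).
have d1 (s t : R) : partial1of2 f s t = partial i U (x t + s *: direction phi i t) * phi t.
  by rewrite partial1of2E; have H := dline s t; exact: derive_val.
have zI : (`](- 1), 1[%classic : set R) 0 by rewrite /= in_itv/=; apply/andP; split; lra.
have intG : integrable01 (fun t => `|B| * `|phi t|).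
  by apply: integrable01Z; apply: integrable01_continuous => t;
    apply: cvg_norm; exact: cphi.
have fi' (s : R) : (`](- 1), 1[%classic : set R) s -> mu.-integrable I01 (EFin \o f s).
  by move=> _; exact: fi.
have df (s t : R) : (`](- 1), 1[%classic : set R) s -> I01 t -> derivable (f ^~ t) s 1.
  by move=> _ _; have H := dline s t; exact: ex_derive.
have ub (s t : R) : (`](- 1), 1[%classic : set R) s -> I01 t ->
    `|partial1of2 f s t| <= `|B| * `|phi t|.
  rewrite /= in_itv/= => /andP[s1 s2] It; rewrite d1 normrM ler_wpM2r//.
  apply: le_trans (ler_norm B); apply: HB.
  apply: (le_trans (ler_normD _ _)); apply: lerD; first exact: HM.
  rewrite normrZ; apply: le_trans (HN _ It); rewrite ler_piMl//.
  by rewrite ler_norml; apply/andP; split; lra.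
have G0 (t : R) : 0 <= `|B| * `|phi t| by rewrite mulr_ge0.
apply: DeriveDef.
  exact: (@derivable_under_integral _ _ _ mu f I01 measurable01 0 (- 1) 1 zI fi' df _ G0 intG ub).
have := @differentiation_under_integral _ _ _ mu f I01 measurable01 0 (- 1) 1 zI fi' df _ G0 intG ub.
rewrite derive1E => ->.
by apply: eq_Rintegral => t _; rewrite d1 scale0r addr0.
Qed.

End Variations.

(** * The equations satisfied by a critical point *)

Section CriticalEquations.
Context {R : realType} {n : nat}.
Implicit Types (x y g h : R -> 'rV[R]_n) (U : 'rV[R]_n -> R).

Local Notation mu := (@lebesgue_measure R).
Local Notation I01 := (`[0%R, 1%R]%classic : set R).
Local Notation integrable01 f := (mu.-integrable I01 (EFin \o f)).

Lemma sqnorm_direction (v : 'rV[R]_n) (s : R) (phi : R -> R) (i : 'I_n) (t : R) :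
  sqnorm (v + s *: direction phi i t) =
  sqnorm v + s * (2 * (v 0 i * phi t)) + s ^+ 2 * phi t ^+ 2.
Proof.
rewrite /sqnorm /dot (bigD1 i)//= [in RHS](bigD1 i)//=.
rewrite (eq_bigr (fun j => v 0 j * v 0 j)); last first.
  by move=> j ji; rewrite !mxE (negPf ji) !(mulr0, addr0, andbF).
by rewrite !mxE !eqxx/= mulr1; ring.
Qed.

Lemma is_derive_unique (f : R -> R) (t l m : R) :
  is_derive t (1 : R) f l -> is_derive t (1 : R) f m -> l = m.
Proof. by move=> [_ <-] [_ <-]. Qed.

(** The kinetic part of the action is a quadratic polynomial in the parameter [s],
whose linear coefficient is the left-hand side up to a power of T, and the
potential part is differentiated by [is_derive_potential]. *)
Lemma critical_weak_equation U (k : R) x g (T : R) (phi : R -> R) (i : 'I_n) :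
  of_class_C 1 U -> {within I01, continuous x} -> is_weak_derivative x g ->
  0 < T -> C1_test_function phi ->
  has_differential (lagrangian U) k x T (direction phi i) 0 0 ->
  \int[mu]_(t in I01) (g t 0 i * derive1 phi t) =
  T ^+ 2 * \int[mu]_(t in I01) (partial i U (x t) * phi t).
Proof.
move=> [dU cdU] cx xg T0 tphi crit.
have cU : continuous U by move=> z; exact: differentiable_continuous.
have cphi := continuous_test tphi.
have cdphi : continuous (derive1 phi) by case: tphi.
have cd : {within I01, continuous (direction phi i)}.
  by apply: continuous_subspaceT; exact: continuous_direction.
have gi : integrable01 (fun t => g t 0 i) by apply: integrable01_L2; have [] := xg i.
have gphi : integrable01 (fun t => 2 * (g t 0 i * derive1 phi t)).
  by apply: integrable01Z; apply: integrable01M => //; exact: continuous_subspaceT.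
have sg : integrable01 (fun t => sqnorm (g t)).
  by apply: integrable01_sqnorm; apply: L2_weak; exists x.
have p2 : integrable01 (fun t => derive1 phi t ^+ 2).
  by apply: integrable01_continuous => t; exact: (cvgM (cdphi t) (cdphi t)).
pose A := \int[mu]_(t in I01) sqnorm (g t).
pose B := \int[mu]_(t in I01) (g t 0 i * derive1 phi t).
pose C := \int[mu]_(t in I01) (derive1 phi t ^+ 2).
pose P s := \int[mu]_(t in I01) U (x t + s *: direction phi i t).
pose q (s : R) : R := 2^-1 * T ^- 2 * (A + s * (2 * B) + s ^+ 2 * C) + k.
have dq : is_derive (0 : R) (1 : R) q (T ^- 2 * B).
  apply: (@is_derive_quadratic _ _ _ _ `|2^-1 * T ^- 2 * C|) => u.
  rewrite subr0 -[X in _ <= _ * X](ger0_norm (sqr_ge0 u)) -normrM.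
  by rewrite le_eqVlt; apply/orP; left; apply/eqP; congr (`| _ |); rewrite /q; field; rewrite gt_eqF.
have dP := is_derive_potential (dU) (cdU i) cx cphi.
have act : (fun s => action (lagrangian U) k (fun t => x t + s *: direction phi i t)
    (T + s * 0)) = T \*: (q - P).
  apply/funext => s; rewrite mulr0 addr0.
  have cxs : {within I01, continuous (fun t => x t + s *: direction phi i t)}.
    by move=> t; apply: cvgD; [exact: cx|apply: cvgZl_tmp; exact: cd].
  have xgs := is_weak_derivativeD s cx cd xg (weak_derivative_direction i tphi).
  rewrite (action_lagrangian k T cU cxs xgs) -[RHS]/(T * (q s - P s)).
  congr (_ * _); rewrite /q [RHS]addrAC; congr (_ - _ + _); congr (_ * _).
  under eq_Rintegral do rewrite sqnorm_direction.
  rewrite RintegralD//; [|by apply: integrable01D => //; exact: integrable01Z|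
                          exact: integrable01Z].
  rewrite RintegralD//; last exact: integrable01Z.
  rewrite !RintegralZl//.
  by apply: integrable01M => //; exact: continuous_subspaceT.
move: crit; rewrite /has_differential act => crit.
have := is_derive_unique crit (is_deriveZ T (is_deriveB dq dP)).
move/esym/eqP; rewrite /GRing.scale/= mulf_eq0 gt_eqF//= subr_eq0 => /eqP <-.
by rewrite -/B mulrA mulfV ?mul1r// expf_neq0// gt_eqF.
Qed.

(** For the unperturbed path the action as a function of T is A / (2T) + (k - W) T,
whose derivative is k minus the mean of the energy. *)
Lemma critical_mean_energy U (k : R) x g (T : R) :
  continuous U -> {within I01, continuous x} -> is_weak_derivative x g ->
  0 < T -> has_differential (lagrangian U) k x T (fun=> 0) 1 0 ->
  2^-1 * T ^- 2 * (\int[mu]_(t in I01) sqnorm (g t)) +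
    \int[mu]_(t in I01) U (x t) = k.
Proof.
move=> cU cx xg T0; rewrite /has_differential.
set A := \int[mu]_(t in I01) sqnorm (g t); set W := \int[mu]_(t in I01) U (x t).
have -> : (fun s => action (lagrangian U) k (fun t => x t + s *: 0) (T + s * 1)) =
    (fun s => 2^-1 * A * (s + T)^-1 + (k - W) * (s + T)).
  apply/funext => s; rewrite mulr1.
  have -> : (fun t => x t + s *: 0) = x by apply/funext => t; rewrite scaler0 addr0.
  rewrite (action_lagrangian _ _ cU cx xg) -/A -/W [s + T]addrC.
  have [->|Ts] := eqVneq (T + s) 0; first by rewrite invr0 mul0r !mulr0 addr0.
  by field.
have d1 : is_derive (0 : R) (1 : R) (fun s : R => s + T) 1 by exact: is_derive_shift.
have T00 : 0 + T != 0 by rewrite add0r gt_eqF.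
have d2 := is_deriveD (is_deriveZ (2^-1 * A) (@is_deriveV _ (fun s => s + T) 0 _ 1 T00 d1))
  (is_deriveZ (k - W) d1).
move=> crit; have := is_derive_unique crit d2.
rewrite /GRing.scale/= !mulr1 add0r => H.
by rewrite -[LHS]addr0 H; ring.
Qed.

Lemma is_derive0_cst01 (f : R -> R) :
  (forall t : R, 0 <= t <= 1 -> is_derive t (1 : R) f 0) ->
  forall t, I01 t -> f t = f 0.
Proof.
move=> df t; rewrite /= in_itv/= => /andP[t0 t1].
have [||c _] := @MVT_segment _ f (fun=> 0) 0 t t0.
- move=> u; rewrite in_itv/= => /andP[u0 ut]; apply: df.
  by rewrite ltW// ltW// (lt_le_trans ut).
- apply/subspace_continuousP => u; rewrite /= in_itv/= => /andP[u0 ut].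
  apply: cvg_within_filter; apply: is_derive_continuous; apply: df.
  by rewrite u0 (le_trans ut).
- by rewrite mul0r => /eqP; rewrite subr_eq0 => /eqP.
Qed.

End CriticalEquations.

(** * Regularity of the potential *)

Section C1.
Context {R : realType} {n : nat}.
Implicit Types (U V W : 'rV[R]_n -> R).

Lemma of_class_C1D U W : of_class_C 1 U -> of_class_C 1 W ->
  of_class_C 1 (fun z => U z + W z).
Proof.
move=> [dU cU] [dW cW]; split=> [z|i z]; first exact: differentiableD.
have -> : partial i (fun z => U z + W z) = (fun z => partial i U z + partial i W z).
  by apply/funext => y; apply: deriveD; exact: diff_derivable.
by apply: continuousD; [exact: cU|exact: cW].
Qed.

Lemma of_class_C1M U W : of_class_C 1 U -> of_class_C 1 W ->
  of_class_C 1 (fun z => U z * W z).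
Proof.
move=> [dU cU] [dW cW]; split=> [z|i z]; first exact: differentiableM.
have -> : partial i (fun z => U z * W z) =
    (fun z => U z * partial i W z + W z * partial i U z).
  by apply/funext => y; apply: deriveM; exact: diff_derivable.
have cU0 := differentiable_continuous (dU z).
have cW0 := differentiable_continuous (dW z).
exact: (continuousD (continuousM cU0 (cW i z)) (continuousM cW0 (cU i z))).
Qed.

Lemma of_class_C1_cst (c : R) : of_class_C 1 (fun _ : 'rV[R]_n => c).
Proof.
split=> [z|i z]; first exact: differentiable_cst.
have -> : partial i (fun _ : 'rV[R]_n => c) = (fun _ => 0).
  by apply/funext => y; exact: derive_cst.
exact: (@cst_continuous _ _ (0 : R) z).
Qed.

Lemma of_class_C1_sum m (F : 'I_m -> 'rV[R]_n -> R) :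
  (forall i, of_class_C 1 (F i)) -> of_class_C 1 (fun z => \sum_i F i z).
Proof.
elim: m F => [|m IH] F HF.
  under [X in of_class_C 1 X]eq_fun do rewrite big_ord0.
  exact: of_class_C1_cst.
under [X in of_class_C 1 X]eq_fun do rewrite big_ord_recl.
by apply: of_class_C1D => //; exact: IH.
Qed.

Lemma of_class_C2_C1 U : of_class_C 2 U -> of_class_C 1 U.
Proof.
move=> [dU pU]; split=> // i z; have [dp _] := pU i.
exact: differentiable_continuous.
Qed.

(** The Laplacian costs two of the four derivatives of [V]. *)
Lemma potential_of_class_C1 (sigma : R) V : of_class_C 4 V ->
  of_class_C 1 (potential sigma V).
Proof.
move=> [_ pV]; apply: of_class_C1D.
  apply: of_class_C1M; first exact: of_class_C1_cst.
  by apply: of_class_C1_sum => i; apply: of_class_C2_C1; have [_] := pV i; exact.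
have -> : (fun z => - (2^-1 * sqnorm (grad V z))) =
    (fun z => - 2^-1 * \sum_i partial i V z * partial i V z).
  apply/funext => z; rewrite mulNr; congr (- (_ * _)).
  by apply: eq_bigr => i _; rewrite mxE.
apply: of_class_C1M; first exact: of_class_C1_cst.
apply: of_class_C1_sum => i; have [dp pp] := pV i.
have C1 : of_class_C 1 (partial i V).
  by split=> // j z; have [d _] := pp j; exact: differentiable_continuous.
exact: of_class_C1M.
Qed.

End C1.

(** * Conservation of energy *)

Section Conclusion.
Context {R : realType} {n : nat}.

Local Notation mu := (@lebesgue_measure R).
Local Notation I01 := (`[0%R, 1%R]%classic : set R).
Local Notation integrable01 f := (mu.-integrable I01 (EFin \o f)).

(** The velocity [p] solves Newton's equation, which makes the energy constant; its mean
is [k]. *)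
Lemma critical_energy_level (U : 'rV[R]_n -> R) (tau k : R) (xm xp : 'rV[R]_n)
    (x : R -> 'rV[R]_n) (T : R) :
  of_class_C 1 U -> critical_point_le (lagrangian U) tau xm xp k x T ->
  exists p : R -> 'rV[R]_n, {within I01, continuous p} /\
    forall t, I01 t -> 2^-1 * sqnorm (T^-1 *: p t) + U (x t) = k.
Proof.
move=> C1U [[[cx [g xg]] _ _] /andP[T0 _] crit].
have [dU cdU] := C1U.
have cU : continuous U by move=> z; exact: differentiable_continuous.
have gi i : integrable01 (fun t => g t 0 i) by apply: integrable01_L2; have [] := xg i.
pose w i t := partial i U (x (clamp01 t)).
have cw i : continuous (w i).
  move=> t; apply: (@cvg_comp _ _ _ (fun t => x (clamp01 t)) (partial i U)); last exact: cdU.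
  exact: (continuous_comp_clamp01 cx).
have wE i t : I01 t -> w i t = partial i U (x t).
  by rewrite /= in_itv/= => It; rewrite /w clamp01_id.
have EL i : exists p : R -> R,
    (forall t : R, 0 <= t <= 1 -> is_derive t (1 : R) p (- (T ^+ 2 * w i t))) /\
    {ae mu, forall t, I01 t -> g t 0 i = p t}.
  apply: weak_euler_lagrange => // phi tphi.
  have weq := critical_weak_equation C1U cx xg T0 tphi (crit _ _ (direction_W12 i tphi)).
  have wI : \int[mu]_(t in I01) (w i t * phi t) =
      \int[mu]_(t in I01) (partial i U (x t) * phi t).
    by apply: eq_Rintegral => t; rewrite inE => It; rewrite wE.
  by rewrite weq wI.
have [p /all_and2[dp gp]] := choice EL.
have cp i : {within I01, continuous (p i)}.
  apply/subspace_continuousP => t It; apply: cvg_within_filter.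
  by apply: (@is_derive_continuous _ _ (- (T ^+ 2 * w i t))); apply: dp; rewrite /= in_itv in It.
have Fx i : exists F : R -> R, (forall t : R, 0 <= t <= 1 -> is_derive t (1 : R) F (p i t)) /\
    forall t, I01 t -> x t 0 i = F t.
  apply: (@weak_primitive _ (fun t => x t 0 i) (fun t => g t 0 i)) => //.
  - exact: within_continuous_coord.
  - by move=> phi tphi; have [_] := xg i; apply.
have [F /all_and2[dF xF]] := choice Fx.
pose X t : 'rV[R]_n := \row_i F i t.
have xX t : I01 t -> x t = X t.
  by move=> It; apply/rowP => i; rewrite mxE xF.
pose P t : 'rV[R]_n := \row_i p i t.
have sP t : sqnorm (P t) = \sum_i p i t ^+ 2.
  by apply: eq_bigr => i _; rewrite !mxE expr2.
pose E t := 2^-1 * T ^- 2 * \sum_i p i t ^+ 2 + U (X t).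
have dE (t : R) : 0 <= t <= 1 -> is_derive t (1 : R) E 0.
  move=> t01; have It : I01 t by rewrite /= in_itv.
  have dX : is_derive t (1 : R) X (\row_i p i t).
    by apply: is_derive_row => i; exact: dF.
  have dUX := is_derive_comp_rV (dU (X t)) dX.
  have dK := is_derive_sum (fun i => is_deriveM (dp i t t01) (dp i t t01)).
  have EF : E = (2^-1 * T ^- 2) \*: (\sum_i (p i * p i)) + (U \o X).
    apply/funext => s; rewrite /E -[RHS]/(2^-1 * T ^- 2 * (\sum_i (p i * p i)) s + U (X s)).
    by rewrite fct_sumE; congr (_ * _ + _); apply: eq_bigr => i _; rewrite expr2.
  rewrite EF; apply: (is_derive_eq (is_deriveD (is_deriveZ _ dK) dUX)).
  rewrite /GRing.scale/= mulr_sumr -big_split/= big1// => i _.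
  by rewrite mxE (wE i t It) -xX//; field; rewrite gt_eqF.
have Ecst t : I01 t -> E t = E 0 by exact: is_derive0_cst01.
have EE t : I01 t -> E t = 2^-1 * sqnorm (T^-1 *: P t) + U (x t).
  move=> It; rewrite /E (xX t It) -sP; congr (_ + _); rewrite -mulrA; congr (_ * _).
  by rewrite /sqnorm /dot !mulr_sumr; apply: eq_bigr => i _; rewrite !mxE; field; rewrite gt_eqF.
have dP t : I01 t -> is_derive t (1 : R) P (\row_i (- (T ^+ 2 * w i t))).
  by rewrite /= in_itv/= => It; apply: is_derive_row => i; exact: dp.
exists P; split.
  apply/subspace_continuousP => t It; apply: cvg_within_filter.
  have H := dP t It; apply: differentiable_continuous; apply/derivable1_diffP.
  exact: ex_derive.
move=> t It; rewrite -EE// Ecst//.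
have := critical_mean_energy cU cx xg T0 (crit _ 1 zero_W12) => <-.
have sgi : integrable01 (fun t => sqnorm (g t)).
  by apply: integrable01_sqnorm; apply: L2_weak; exists x.
have sPi : integrable01 (fun t => sqnorm (P t)).
  apply: (@integrable01_eq _ (fun t => \sum_i p i t * p i t)).
    by move=> s _; rewrite sP; apply: eq_bigr => i _; rewrite expr2.
  apply: integrable01_sum => i; apply: integrable01M => //.
  exact: integrable01_within.
have -> : \int[mu]_(t in I01) sqnorm (g t) = \int[mu]_(t in I01) sqnorm (P t).
  apply: ae_eq_Rintegral01 => //.
  have : \forall t \ae mu, forall i, I01 t -> g t 0 i = p i t.
    by apply: filter_forall gp; exact: (ae_filter_ringOfSetsType mu).
  apply: filterS; first exact: (ae_filter_ringOfSetsType mu).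
  move=> s H Is; congr sqnorm; apply/rowP => i; rewrite mxE; exact: H.
rewrite -RintegralZl// -RintegralD//.
- rewrite -[LHS](@integral01_cst R (E 0)); apply: eq_Rintegral => s; rewrite inE => Is.
  by rewrite -(Ecst s Is) /E -sP xX.
- exact: integrable01Z.
- exact: integrable01_within (within_continuous_comp cU cx).
Qed.

(** The image of [0,1] under t |-> (x t, p t / T) is connected, lies in the energy level,
and meets the fibers over both endpoints. *)
Lemma critical_level_connected (U : 'rV[R]_n -> R) (tau k : R) (xm xp : 'rV[R]_n)
    (x : R -> 'rV[R]_n) (T : R) :
  of_class_C 1 U -> critical_point_le (lagrangian U) tau xm xp k x T ->
  exists Omega, [/\ is_connected_component (energy_level (lagrangian U) k) Omega,
      Omega `&` cotangent_fiber xm !=set0 & Omega `&` cotangent_fiber xp !=set0].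
Proof.
move=> C1U crit; have [p [cp pE]] := critical_energy_level C1U crit.
have [[[cx _] xx0 xx1] _ _] := crit.
pose z t : 'rV[R]_n * 'rV[R]_n := (x t, T^-1 *: p t).
have cz : {within I01, continuous z}.
  apply/subspace_continuousP => t It.
  move/subspace_continuousP : cx => /(_ t It) cxt.
  move/subspace_continuousP : cp => /(_ t It) cpt.
  have cTp : T^-1 *: p s @[s --> within I01 (nbhs t)] --> T^-1 *: p t.
    by apply: cvgZl_tmp; exact: cpt.
  by have := cvg_pair cxt cTp; apply.
have zE t : I01 t -> energy_level (lagrangian U) k (z t).
  by move=> It; rewrite /energy_level/= legendre_dual_lagrangian/= pE.
have I0 : I01 0 by rewrite /= in_itv/= lexx ler01.
have I1 : I01 1 by rewrite /= in_itv/= lexx ler01.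
have conn : connected (z @` I01).
  apply: connected_continuous_connected => //; exact: segment_connected.
have sub : z @` I01 `<=` connected_component (energy_level (lagrangian U) k) (z 0).
  apply: connected_component_max conn; first by exists (0 : R).
  by move=> _ [t It <-]; exact: zE.
exists (connected_component (energy_level (lagrangian U) k) (z 0)); split.
- by exists (z 0) => //; exact: zE.
- by exists (z 0); split => //; apply: sub; exists (0 : R).
- by exists (z 1); split => //; apply: sub; exists (1 : R).
Qed.

End Conclusion.

Theorem theorem2p6 (R : realType) (n : nat) (sigma : R) (V : 'rV[R]_n -> R)
    (x0 x1 xm xp : 'rV[R]_n) (tau k : R) (x : R -> 'rV[R]_n) (T : R) :
  let U := potential sigma V in
  let L := lagrangian U in
  0 < sigma ->
  of_class_C 4 V ->
  (exists M : R, forall y, U y <= M) ->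
  (exists2 D, bounded_domain D & maximum_points U `<=` D) ->
  x0 <> x1 ->
  local_minimizer V x0 -> local_minimizer V x1 ->
  grad V x0 = 0 -> grad V x1 = 0 ->
  0 < laplacian V x0 -> 0 < laplacian V x1 ->
  0 < tau ->
  critical_point_le L tau xm xp k x T ->
  T < tau ->
  (k0 L xm xp <= k%:E)%E.
Proof.
move=> U L _ C4 _ _ _ _ _ _ _ _ _ _ crit _.
apply: ereal_inf_lbound; exists k => //.
exact: critical_level_connected (potential_of_class_C1 sigma C4) crit.
Qed.
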